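(* Let $l\geq 4$ be an integer and let $\Sigma$ be a finite family of mutually skew lines in $\mathbb{R}^l$ such that, for every two distinct lines in $\Sigma$, the three dimensional affine hull of these two lines contains at least one further line of $\Sigma$. Then $\Sigma$ is entirely contained in a three dimensional affine subspace of $\mathbb{R}^l$ if and only if the arrangement of these affine hulls is central, i.e. the intersection of all the three dimensional affine hulls of pairs of distinct lines in $\Sigma$ is non-empty.
   Context: Two lines in $\mathbb{R}^l$ are skew if they are neither intersecting nor parallel, equivalently the smallest affine subspace containing both (their affine hull) has dimension $3$. A family of lines is mutually skew if any two distinct members are skew. *)

(* Defs.v *)
From mathcomp Require Import all_boot all_order all_algebra.
From mathcomp Require Import boolp classical_sets functions cardinality reals.

Set Implicit Arguments.
Unset Strict Implicit.
Unset Printing Implicit Defensive.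

Local Open Scope classical_set_scope.
Local Open Scope ring_scope.

Definition affine_subspace (R : realType) (l k : nat) (A : set 'rV[R]_l) :=
  exists (p : 'rV[R]_l) (V : {vspace 'rV[R]_l}),
    \dim V = k /\ A = [set x | x - p \in V].

Definition line (R : realType) (l : nat) (L : set 'rV[R]_l) :=
  affine_subspace 1 L.

Definition parallel (R : realType) (l : nat) (L M : set 'rV[R]_l) :=
  exists v : 'rV[R]_l, M = [set x + v | x in L].

Definition skew_lines (R : realType) (l : nat) (L M : set 'rV[R]_l) :=
  ~ (L `&` M !=set0) /\ ~ parallel L M.

Definition affine_hull (R : realType) (l : nat) (X : set 'rV[R]_l) :
    set 'rV[R]_l :=
  \bigcap_(A in [set A | (exists k, affine_subspace k A) /\ X `<=` A]) A.

Definition pair_hulls (R : realType) (l : nat) (Sigma : set (set 'rV[R]_l)) :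
    set (set 'rV[R]_l) :=
  [set H | exists L M : set 'rV[R]_l,
     [/\ Sigma L, Sigma M, L <> M & H = affine_hull (L `|` M)]].

(* The intersection of the empty arrangement is the whole space, so it is
   central. *)
Definition central (R : realType) (l : nat) (Arr : set (set 'rV[R]_l)) :=
  \bigcap_(H in Arr) H !=set0.

(* Main.v *)
Require Import Defs.
From mathcomp Require Import all_boot all_order all_algebra.
From mathcomp Require Import boolp classical_sets functions cardinality reals.
From mathcomp Require Import zify ring lra.

(** Let [p] lie in all the hulls, and let [P_L] be the linear span of [L - p]
    (a plane, unless [p] is on [L]). Then the hull of [L] and [M] is
    [p + (P_L + P_M)], so that [P_L + P_M] has dimension 3. If not all these
    hulls coincide, there are three planes [P_L], [P_M], [P_N], pairwise meeting
    in lines, with [P_N] outside [P_L + P_M]; this forces all the planes to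
    share a line [E]. In the projective space of planes through [E], the points
    [P_L + E] satisfy the hypothesis of the Sylvester-Gallai theorem, hence are
    collinear, a contradiction. *)

Import Order.TTheory GRing.Theory Num.Theory.
Local Open Scope classical_set_scope.
Local Open Scope ring_scope.

(** * The dot product on row vectors *)

Definition dot {R : comNzRingType} {n : nat} (u v : 'rV[R]_n) : R :=
  \sum_i u 0 i * v 0 i.

Section DotAlgebra.
Set Implicit Arguments.
Unset Strict Implicit.
Variables (R : comNzRingType) (n : nat).
Implicit Types (a : R) (u v w : 'rV[R]_n).

Lemma dotC u v : dot u v = dot v u.
Proof. by apply: eq_bigr => i _; rewrite mulrC. Qed.

Lemma dotDl u v w : dot (u + v) w = dot u w + dot v w.
Proof. by rewrite /dot -big_split; apply: eq_bigr => i _; rewrite mxE mulrDl. Qed.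

Lemma dotZl a u v : dot (a *: u) v = a * dot u v.
Proof. by rewrite /dot mulr_sumr; apply: eq_bigr => i _; rewrite mxE mulrA. Qed.

Lemma dotNl u v : dot (- u) v = - dot u v.
Proof. by rewrite -scaleN1r dotZl mulN1r. Qed.

Lemma dotDr u v w : dot w (u + v) = dot w u + dot w v.
Proof. by rewrite dotC dotDl !(dotC w). Qed.

Lemma dotZr a u v : dot u (a *: v) = a * dot u v.
Proof. by rewrite dotC dotZl dotC. Qed.

Lemma dotNr u v : dot u (- v) = - dot u v.
Proof. by rewrite dotC dotNl dotC. Qed.

Definition dotE := (dotDl, dotDr, dotZl, dotZr, dotNl, dotNr).
End DotAlgebra.

(** * Euclidean distances and the Sylvester-Gallai theorem *)

Section SylvesterGallai.
Set Implicit Arguments.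
Unset Strict Implicit.
Variables (R : realFieldType) (n : nat).
Implicit Types (u v w x y z : 'rV[R]_n).

Lemma dot_ge0 u : 0 <= dot u u.
Proof. by apply: sumr_ge0 => i _; rewrite -expr2 sqr_ge0. Qed.

Lemma dot_eq0 u : (dot u u == 0) = (u == 0).
Proof.
apply/eqP/eqP => [|->]; last by rewrite /dot big1 // => i _; rewrite mxE mul0r.
move/eqP; rewrite psumr_eq0 => [/allP h|i _]; last by rewrite -expr2 sqr_ge0.
apply/rowP => i; rewrite mxE; apply/eqP.
by have := h i; rewrite mem_index_enum mulf_eq0 orbb => /(_ isT).
Qed.

Lemma dot_gt0 u : (0 < dot u u) = (u != 0).
Proof. by rewrite lt_def dot_ge0 andbT dot_eq0. Qed.

(** The orthogonal projection of [z] on the line through [x] and [y]. Working with squared distances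
    avoids square roots. *)
Definition foot x y z := x + (dot (z - x) (y - x) / dot (y - x) (y - x)) *: (y - x).
Definition sqdist x y z := dot (z - foot x y z) (z - foot x y z).

Lemma sqdistE x y z : x != y ->
  sqdist x y z = dot (z - x) (z - x)
    - dot (z - x) (y - x) ^+ 2 / dot (y - x) (y - x).
Proof.
rewrite eq_sym -subr_eq0 -dot_eq0 /sqdist /foot opprD addrA.
move: (z - x) (y - x) => u v v0; rewrite !dotE (dotC v u).
by field.
Qed.

(* Kelly's argument: [q] is the foot of [q + h] on the line, and of two points on
   the same side of [q], the one nearer to [q], with parameter [b], is closer to
   the line through [q + h] and the other than [q + h] is to the given line. *)
Lemma kelly_step (q e h : 'rV[R]_n) (b c : R) : dot h e = 0 -> h != 0 ->
  e != 0 -> b != c -> 0 <= b * c -> b ^+ 2 <= c ^+ 2 ->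
  0 < sqdist (q + c *: e) (q + h) (q + b *: e) < dot h h.
Proof.
move=> he h0 e0 bc bc0 lebc.
have c0 : c != 0.
  apply: contraNneq bc => c0; move: lebc; rewrite c0 expr0n /= => h2.
  by rewrite -sqrf_eq0 eq_le h2 sqr_ge0.
have D0 : 0 < dot h h by rewrite dot_gt0.
have E0 : 0 < dot e e by rewrite dot_gt0.
have c2 : 0 < c ^+ 2 by rewrite lt_def sqr_ge0 sqrf_eq0 c0.
have d2 : 0 < (b - c) ^+ 2 by rewrite lt_def sqr_ge0 sqrf_eq0 subr_eq0 bc.
have cE0 : 0 < c ^+ 2 * dot e e by rewrite mulr_gt0.
have G0 : 0 < c ^+ 2 * dot e e + dot h h by rewrite addr_gt0.
have ne : q + c *: e != q + h.
  apply: contraTneq D0 => /addrI hc; move: he.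
  by rewrite -hc !dotE => hc0; rewrite hc0 mulr0 ltxx.
(* Twice the area of the triangle on these three points, in two ways: the base along [e] has height
   [h], and the sought distance is the height on the opposite side. *)
have -> : sqdist (q + c *: e) (q + h) (q + b *: e)
    = (b - c) ^+ 2 * dot e e * dot h h / (c ^+ 2 * dot e e + dot h h).
  rewrite sqdistE //.
  have -> : q + b *: e - (q + c *: e) = (b - c) *: e.
    by rewrite opprD addrACA subrr add0r scalerBl.
  have -> : q + h - (q + c *: e) = h - c *: e.
    by rewrite opprD addrACA subrr add0r.
  rewrite !dotE (dotC e h) he.
  by field; exact: lt0r_neq0.
apply/andP; split; first by apply: divr_gt0 => //; apply: mulr_gt0 => //; exact: mulr_gt0.
(* Both sides are nonnegative, so their squares may be compared. With [0 <= b * c] this yields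
   [(b - c) ^+ 2 <= c ^+ 2]. *)
have bbc : b ^+ 2 <= b * c.
  by rewrite -ler_sqr ?nnegrE ?sqr_ge0 // !exprMn ler_wpM2l ?sqr_ge0.
rewrite ltr_pdivrMr // mulrC ltr_pM2l //.
rewrite (le_lt_trans (_ : _ <= c ^+ 2 * dot e e)) ?ltrDl //.
have -> : (b - c) ^+ 2 = b ^+ 2 - b * c - b * c + c ^+ 2 by ring.
by rewrite ler_pM2r //; lra.
Qed.

(** Pigeonhole on signs: if [a * b] and [a * c] are negative, [b] and [c] are both opposite to [a].
    The order of the squares prepares [kelly_step]. *)
Lemma same_side (a b c : R) : a != b -> a != c -> b != c ->
  exists s t : R, [/\ s \in [:: a; b; c], t \in [:: a; b; c], s != t,
    0 <= s * t & s ^+ 2 <= t ^+ 2].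
Proof.
have sym (x y : R) : x != y -> 0 <= x * y -> {subset [:: x; y] <= [:: a; b; c]} ->
    exists s t : R, [/\ s \in [:: a; b; c], t \in [:: a; b; c], s != t,
      0 <= s * t & s ^+ 2 <= t ^+ 2].
  move=> xy xy0 sub; have [h|/ltW h] := lerP (x ^+ 2) (y ^+ 2).
    by exists x, y; split=> //; apply: sub; rewrite !inE eqxx ?orbT.
  by exists y, x; split; rewrite ?[y * x]mulrC 1?eq_sym //;
     apply: sub; rewrite !inE eqxx ?orbT.
move=> ab ac bc.
have [h|h1] := lerP 0 (a * b).
  by apply: (sym a b) => // x; rewrite !inE => /orP[]->; rewrite ?orbT.
have [h|h2] := lerP 0 (a * c).
  by apply: (sym a c) => // x; rewrite !inE => /orP[]->; rewrite ?orbT.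
apply: (sym b c) => //; last by move=> x; rewrite !inE => /orP[]->; rewrite ?orbT.
have : 0 < (a * b) * (a * c) by rewrite nmulr_rgt0.
have -> : (a * b) * (a * c) = a ^+ 2 * (b * c) by ring.
move=> h; rewrite leNgt; apply: contraTN h => h; rewrite -leNgt.
by rewrite mulr_ge0_le0 ?sqr_ge0 // ltW.
Qed.

(** Among the triples of two distinct points and a point off their line, one at least distance would
    yield a closer one by [kelly_step]. The family may repeat points, so distinctness concerns
    values of [a]. *)
Theorem sylvester_gallai (I : finType) (a : I -> 'rV[R]_n) :
  (forall i j, a i != a j -> exists k t,
     [/\ a k != a i, a k != a j & a k = a i + t *: (a j - a i)]) ->
  forall i j k, a i != a j -> exists t, a k = a i + t *: (a j - a i).
Proof.
move=> third.
pose P (x : I * I * I) :=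
  (a x.1.1 != a x.1.2) && (0 < sqdist (a x.1.1) (a x.1.2) (a x.2)).
suff noP (x : I * I * I) : ~~ P x.
  move=> i j k ij; have := noP (i, j, k); rewrite /P /= ij /= dot_gt0 negbK.
  by rewrite subr_eq0 => /eqP ->; rewrite /foot; eexists.
apply/negP => Px.
have [[[i j] k] /andP[/= ij]] :=
  arg_minP (fun x : I * I * I => sqdist (a x.1.1) (a x.1.2) (a x.2)) Px.
set f := foot (a i) (a j) (a k); set h := a k - f.
move=> d0 min; set e := a j - a i.
have e0 : e != 0 by rewrite subr_eq0 eq_sym.
have h0 : h != 0 by rewrite -dot_gt0.
have he : dot h e = 0.
  rewrite /h /f /foot -/e opprD addrA dotDl dotNl dotZl.
  by rewrite divfK ?dot_eq0 // subrr.
have [m [t [mi mj mE]]] := third i j ij.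
(* The foot has parameter [s] from [a i]; measured from the foot, the three points on the line have
   parameters [- s], [1 - s] and [t - s]. *)
pose s := dot (a k - a i) e / dot e e.
have iE : a i = f + (- s) *: e by rewrite /f /foot -/e -/s scaleNr addrK.
have jE : a j = f + (1 - s) *: e.
  by rewrite /f /foot -/e -/s -addrA -scalerDl [s + _]addrC subrK scale1r addrC subrK.
have {}mE : a m = f + (t - s) *: e.
  by rewrite mE -/e /f /foot -/e -/s -addrA -scalerDl [s + _]addrC subrK.
have [] := @same_side (- s) (1 - s) (t - s).
- by apply: contraNneq ij => hs; rewrite iE jE -hs.
- by apply: contraNneq mi => hs; rewrite iE mE -hs.
- by apply: contraNneq mj => hs; rewrite jE mE -hs.
move=> b [c [bI cI bc bc0 lebc]].
have onl (r : R) : r \in [:: - s; 1 - s; t - s] -> exists o, a o = f + r *: e.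
  by rewrite !inE => /or3P[]/eqP ->; [exists i|exists j|exists m].
have [ob obE] := onl _ bI; have [oc ocE] := onl _ cI.
have kE : a k = f + h by rewrite /h addrC subrK.
have /andP[l1 l2] := kelly_step f he h0 e0 bc bc0 lebc.
move: l1 l2; rewrite -kE -obE -ocE => l1 l2.
have ock : a oc != a k.
  apply: contraNneq h0 => eqk; move: he.
  have -> : h = c *: e by rewrite /h -eqk ocE addrC addKr.
  by rewrite dotZl => /eqP; rewrite mulf_eq0 dot_eq0 (negPf e0) orbF => /eqP ->; rewrite scale0r.
have := min (oc, k, ob); rewrite /P /= ock l1 => /(_ isT).
by rewrite leNgt /sqdist -/f -/h l2.
Qed.

(** Look for [w] on the moment curve (1, t, t^2, ...): there [dot w (v i)] is a nonzero polynomial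
    in t, and the product of these has a non-root. *)
Lemma exists_nonorthogonal (I : finType) (v : I -> 'rV[R]_n) :
  (forall i, v i != 0) -> exists w, forall i, dot w (v i) != 0.
Proof.
move=> v0; pose p i : {poly R} := rVpoly (v i).
have p0 i : p i != 0.
  apply: contraNneq (v0 i) => pi0.
  by rewrite -(rVpolyK (v i)) -/(p i) pi0 linear0.
have P0 : \prod_i p i != 0 by apply/prodf_neq0 => i _.
have [t tP] : exists t, ~~ root (\prod_i p i) t.
  (* One value more than the degree, all distinct in characteristic zero. *)
  pose s : seq R := [seq k%:R | k <- iota 0 (size (\prod_i p i))].
  have /allPn[t _ ht] : ~~ all (root (\prod_i p i)) s.
    apply/negP => /(max_poly_roots P0).
    rewrite map_inj_uniq ?iota_uniq; last by move=> x y /eqP; rewrite eqr_nat => /eqP.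
    by move=> /(_ isT); rewrite size_map size_iota ltnn.
  by exists t.
exists (\row_j t ^+ j) => i.
have -> : dot (\row_j t ^+ j) (v i) = (p i).[t].
  rewrite /p /rVpoly horner_poly; apply: eq_bigr => j _.
  by rewrite mxE mulrC valK.
apply: contraNN tP => pit; rewrite /root horner_prod.
by apply/prodf_eq0; exists i.
Qed.

End SylvesterGallai.

(** * Dimensions of subspaces *)

Section Subspaces.
Set Implicit Arguments.
Unset Strict Implicit.
Variables (K : fieldType) (vT : vectType K).
Implicit Types (U V W : {vspace vT}) (v : vT).

Lemma dimv_add_line U v : v \notin U -> \dim (U + <[v]>) = (\dim U).+1.
Proof.
move=> vU; have v0 : v != 0 by apply: contraNneq vU => ->; rewrite mem0v.
rewrite dimv_disjoint_sum ?dim_vline ?v0 ?addn1 //.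
apply/eqP; rewrite -subv0; apply/subvP => x /memv_capP[xU /vlineP[k xE]].
rewrite memv0 xE scaler_eq0; apply/orP; left; apply: contraNT vU => k0.
by rewrite -(scale1r v) -(mulVf k0) -scalerA -xE memvZ.
Qed.

Lemma exists_subspace_above U k : (\dim U <= k <= \dim {:vT})%N ->
  exists2 V, (U <= V)%VS & \dim V = k.
Proof.
elim: k => [|k IH] /andP[].
  by rewrite leqn0 => /eqP dU _; exists U; rewrite ?subvv.
rewrite leq_eqVlt => /orP[/eqP dU _|]; first by exists U; rewrite ?subvv.
rewrite ltnS => dU ltk; have [|V UV dV] := IH; first by rewrite dU ltnW.
have /subvPn[v _ vV] : ~~ ({:vT} <= V)%VS.
  by apply/negP => /dimvS; rewrite dV leqNgt ltk.
exists (V + <[v]>)%VS; last by rewrite dimv_add_line ?dV.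
exact: subv_trans UV (addvSl _ _).
Qed.
End Subspaces.

(** * Sylvester-Gallai for planes through a common line *)

Section PlaneFamilies.
Set Implicit Arguments.
Unset Strict Implicit.
Variables (R : realFieldType) (n : nat) (I : finType).
Implicit Types (E U V W : {vspace 'rV[R]_n}).

(* Planes through a common line are the points of a projective space; the chart
   [dot x d = 0], [dot w x = 1] turns them into affine points. *)
Lemma sylvester_gallai_pencil E (Q : I -> {vspace 'rV[R]_n}) :
  \dim E = 1%N -> (forall i, \dim (Q i) = 2%N) -> (forall i, (E <= Q i)%VS) ->
  injective Q ->
  (forall i j, i != j -> exists k,
     [/\ k != i, k != j & (Q k <= Q i + Q j)%VS]) ->
  forall i j k, i != j -> (Q k <= Q i + Q j)%VS.
Proof.
move=> dE dQ EQ Qinj third.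
have [d Ed] : exists d, E = <[d]>%VS.
  exists (vpick E); apply/esym/eqP; rewrite eqEdim -memvE memv_pick dE.
  by rewrite dim_vline vpick0 -dimv_eq0 dE.
have d0 : d != 0 by move: dE; rewrite Ed dim_vline; case: (d != 0).
have dd0 : dot d d != 0 by rewrite dot_eq0.
have /choice[v vP] i : exists v, [/\ v \in Q i, v != 0 & dot v d = 0].
  have /subvPn[u uQ uE] : ~~ (Q i <= E)%VS.
    by apply/negP => /dimvS; rewrite dQ dE.
  have dE' : d \in E by rewrite Ed memv_line.
  exists (u - (dot u d / dot d d) *: d); split.
  - by rewrite memvB ?memvZ // (subvP (EQ i)).
  - apply: contraNneq uE => /eqP; rewrite subr_eq0 => /eqP ->.
    by rewrite memvZ.
  - by rewrite dotDl dotNl dotZl divfK // subrr.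
(* The hyperplane orthogonal to [w] serves as the hyperplane at infinity: it contains no [v i], so
   each can be scaled into the chart. *)
have [w wP] : exists w, forall i, dot w (v i) != 0.
  by apply: exists_nonorthogonal => i; have [] := vP i.
have /choice[a aP] i : exists x, [/\ x \in Q i, dot x d = 0 & dot w x = 1].
  have [vQ _ vd] := vP i; exists ((dot w (v i))^-1 *: v i).
  by rewrite memvZ // dotZl vd mulr0 dotZr mulVf.
have aQ i : a i \in Q i by have [] := aP i.
have ad i : dot (a i) d = 0 by have [] := aP i.
have wa i : dot w (a i) = 1 by have [] := aP i.
have QE i : Q i = (<[d]> + <[a i]>)%VS.
  apply/esym/eqP; rewrite eqEdim; apply/andP; split.
    by rewrite subv_add -Ed EQ -memvE aQ.
  rewrite dQ dimv_add_line -?Ed ?dE // Ed.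
  apply/vlineP => -[c ac]; have := wa i; have := ad i.
  rewrite ac dotZl => /eqP; rewrite mulf_eq0 (negPf dd0) orbF => /eqP ->.
  by rewrite dotZr mul0r => /eqP; rewrite eq_sym oner_eq0.
(* Pairing the decomposition of [a k] with [d] cancels the multiples of [d]; pairing it with [w]
   then shows that the other coefficients sum to 1. *)
have line_of i j k : (Q k <= Q i + Q j)%VS -> exists t, a k = a i + t *: (a j - a i).
  move=> /subvP/(_ _ (aQ k)); rewrite !QE.
  case/memv_addP => _ /memv_addP[_ /vlineP[c1 ->] [_ /vlineP[b1 ->] ->]].
  case=> _ /memv_addP[_ /vlineP[c2 ->] [_ /vlineP[b2 ->] ->]] akE.
  have := ad k; have := wa k; rewrite akE !dotE !wa !ad !mulr0 !addr0 !mulr1.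
  rewrite -mulrDl => h1 /eqP; rewrite mulf_eq0 (negPf dd0) orbF => /eqP c0.
  exists b2; rewrite addrACA -scalerDl c0 scale0r add0r.
  have -> : b1 = 1 - b2.
    by move: h1; rewrite addrACA -mulrDl c0 mul0r add0r => <-; rewrite addrK.
  by rewrite scalerBl scale1r scalerBr -addrA [- _ + _]addrC.
have ainj : injective a by move=> i j aij; apply: Qinj; rewrite !QE aij.
move=> i j k ij.
have [||t akE] := @sylvester_gallai _ _ _ a _ i j k.
- move=> i' j' aij.
  have ij' : i' != j' by apply: contraNneq aij => ->.
  have [m [mi mj /line_of[t mE]]] := third i' j' ij'.
  by exists m, t; split; rewrite ?(inj_eq ainj).
- by rewrite (inj_eq ainj).
rewrite [Q k]QE subv_add -Ed (subv_trans (EQ i)) ?addvSl //= -memvE akE.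
by rewrite scalerBr addrCA addrC memv_add ?memvZ // memvB ?memvZ.
Qed.
End PlaneFamilies.

(** * Families of spaces with pairwise sums of dimension 3 *)

Section PairwiseThreeDim.
Set Implicit Arguments.
Unset Strict Implicit.
Variables (R : realFieldType) (n : nat) (I : finType).
Variable P : I -> {vspace 'rV[R]_n}.
Hypothesis dP : forall i, (\dim (P i) <= 2)%N.
Hypothesis dPP : forall i j, i != j -> \dim (P i + P j) = 3%N.
Hypothesis third : forall i j, i != j -> exists k,
  [/\ k != i, k != j & (P k <= P i + P j)%VS].

Lemma sum_exchange i j k : i != j -> k != i -> (P k <= P i + P j)%VS ->
  (P i + P k = P i + P j)%VS.
Proof.
move=> ij ki kij; apply/eqP; rewrite eqEdim subv_add addvSl kij /=.
by rewrite !dPP // eq_sym.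
Qed.

(** Otherwise the sum would have dimension at most 2. Thus at most one member of the family is not a
    plane. *)
Lemma dim2_or i j : i != j -> \dim (P i) = 2%N \/ \dim (P j) = 2%N.
Proof.
move=> ij; have := dPP ij; have := dP i; have := dP j.
have := dimv_add_leqif (P i) (P j) => -[+ _]; lia.
Qed.

Lemma cap_dim i j : i != j -> \dim (P i) = 2%N -> \dim (P j) = 2%N ->
  \dim (P i :&: P j) = 1%N.
Proof. move=> ij di dj; have := dimv_sum_cap (P i) (P j); rewrite dPP //; lia. Qed.

(** Of [P i], [P j] and a third member of their sum, at most one is not a plane; by [sum_exchange]
    the others span the same sum. *)
Lemma exists_planes_span i j : i != j -> exists i' j',
  [/\ i' != j', \dim (P i') = 2%N, \dim (P j') = 2%N & (P i' + P j' = P i + P j)%VS].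
Proof.
move=> ij; have [k [ki kj kij]] := third ij.
have kji : (P k <= P j + P i)%VS by rewrite addvC.
have ji : j != i by rewrite eq_sym.
have [di|di] := eqVneq (\dim (P i)) 2; last first.
  exists j, k; split; rewrite 1?eq_sym //.
  - by case: (dim2_or ij) => // d; rewrite d in di.
  - by case: (dim2_or ki) => // d; rewrite d in di.
  - by rewrite (sum_exchange ji) // addvC.
have [dj|dj] := eqVneq (\dim (P j)) 2; first by exists i, j.
exists i, k; split; rewrite 1?eq_sym ?(sum_exchange ij) //.
by case: (dim2_or kj) => // d; rewrite d in dj.
Qed.

(** If [P k] is not a plane, a third member of [P i + P k] is. Were it inside [P i + P j], exchange
    would put [P k] there too. *)
Lemma exists_plane_outside i j k : i != j -> ~~ (P k <= P i + P j)%VS ->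
  exists2 m, \dim (P m) = 2%N & ~~ (P m <= P i + P j)%VS.
Proof.
move=> ij kij; have [dk|dk] := eqVneq (\dim (P k)) 2; first by exists k.
have ik : i != k by apply: contraNneq kij => <-; apply: addvSl.
have [m [mi mk mik]] := third ik; exists m.
  by case: (dim2_or mk) => // d; rewrite d in dk.
apply: contraNN kij => mij.
by apply: subv_trans (addvSr (P i) _) _; rewrite -(sum_exchange ik mi mik) subv_add addvSl.
Qed.

(* Planes that meet pairwise in lines and do not all lie in a 3-space share a
   line: here [E], the trace of [P m] on the 3-space [P i + P j]. *)
Lemma exists_common_line i j m : i != j ->
  \dim (P i) = 2%N -> \dim (P j) = 2%N -> \dim (P m) = 2%N ->
  ~~ (P m <= P i + P j)%VS ->
  exists2 E, \dim E = 1%N & forall k, \dim (P k) = 2%N -> (E <= P k)%VS.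
Proof.
move=> ij di dj dm mij; set W := (P i + P j)%VS.
have dW : \dim W = 3%N by apply: dPP.
have trace k : \dim (P k) = 2%N -> ~~ (P k <= W)%VS -> (\dim (P k :&: W) <= 1)%N.
  move=> dk; apply: contraNT; rewrite -ltnNge => d2.
  have /eqP <- : (P k :&: W)%VS == P k by rewrite eqEdim capvSl dk.
  exact: capvSr.
have trace_eq k l : \dim (P k) = 2%N -> ~~ (P k <= W)%VS -> \dim (P l) = 2%N ->
    (P l <= W)%VS -> (P k :&: P l = P k :&: W)%VS.
  move=> dk kW dl lW; apply/eqP; rewrite eqEdim capvS //=.
  by rewrite cap_dim // ?trace //; apply: contraNneq kW => ->.
have iW : (P i <= W)%VS by apply: addvSl.
have jW : (P j <= W)%VS by apply: addvSr.
(* The trace lies in both [P i] and [P j], and their intersection is only a line. *)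
have cap_ij k : \dim (P k) = 2%N -> ~~ (P k <= W)%VS ->
    (P k :&: W = P i :&: P j)%VS.
  move=> dk kW; apply/eqP; rewrite eqEdim cap_dim //.
  rewrite -{2}(trace_eq k i) // cap_dim //; last by apply: contraNneq kW => ->.
  by rewrite subv_cap -{1}(trace_eq k i) // -(trace_eq k j) // !capvSr.
exists (P i :&: P j)%VS; first exact: cap_dim.
move=> k dk; have [kW|kW] := boolP (P k <= W)%VS.
  by rewrite -(cap_ij m) // -(trace_eq m k) // capvSr.
by rewrite -(cap_ij k) // capvSl.
Qed.

Theorem pairwise_spans_coincide i j k : i != j -> (P k <= P i + P j)%VS.
Proof.
move=> ij; apply: contraT => kij.
have [i' [j' [ij' di dj ijE]]] := exists_planes_span ij.
have [m dm mij] := exists_plane_outside ij kij.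
rewrite -ijE in mij.
have [E dE EP] := exists_common_line ij' di dj dm mij.
(* Adding [E] keeps the planes unchanged and turns a possible exceptional member into a plane
   through [E]. *)
pose Q k := (P k + E)%VS.
have QP l : \dim (P l) = 2%N -> Q l = P l by move=> dl; apply/addv_idPl/EP.
have dQ l : \dim (Q l) = 2%N.
  have [dl|dl] := eqVneq (\dim (P l)) 2; first by rewrite QP.
  have li : l != i' by apply: contraNneq dl => ->; rewrite di.
  have dl1 : (\dim (P l) <= 1)%N by move: (dP l) dl; lia.
  have dl1' : (1 <= \dim (P l))%N.
    have := dPP li; have := dimv_add_leqif (P l) (P i') => -[+ _]; lia.
  (* Otherwise [P l] would be [E], hence inside [P i'], and their sum would have dimension 2. *)
  have EPl : ~~ (E <= P l)%VS.
    apply/negP => El; have /eqP EE : E == P l by rewrite eqEdim El dE.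
    have := dPP li; have /addv_idPr -> : (P l <= P i')%VS by rewrite -EE EP.
    by rewrite di.
  have : (\dim (P l :&: E) < \dim E)%N.
    rewrite ltn_neqAle dimvS ?capvSr // andbT; apply: contraNN EPl => /eqP h.
    have /eqP <- : (P l :&: E)%VS == E by rewrite eqEdim capvSr h leqnn.
    exact: capvSl.
  have := dimv_sum_cap (P l) E; rewrite -/(Q l) dE; lia.
have Qinj : injective Q.
  move=> x y xy; apply/eqP; apply: contraT => nxy.
  have : (P x + P y <= Q x)%VS by rewrite subv_add {2}xy !addvSl.
  by move/dimvS; rewrite dQ dPP.
have : (Q m <= Q i' + Q j')%VS.
  apply: (@sylvester_gallai_pencil _ _ _ E) => //.
    by move=> l; apply: addvSr.
  move=> x y xy; have [l [lx ly lxy]] := third xy; exists l; split=> //.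
  rewrite subv_add (subv_trans lxy) ?addvS ?addvSl //=.
  by rewrite (subv_trans (addvSr (P x) E)) ?addvSl.
by rewrite !QP // (negPf mij).
Qed.
End PairwiseThreeDim.

(** * Affine flats, hulls of skew lines and central arrangements *)

Section Flats.
Set Implicit Arguments.
Unset Strict Implicit.
Variables (R : realType) (l : nat).
Implicit Types (p q a b x : 'rV[R]_l) (U V W Z : {vspace 'rV[R]_l}).

Definition flat p W : set 'rV[R]_l := [set x | x - p \in W].

Lemma affine_flat p W : affine_subspace (\dim W) (flat p W).
Proof. by exists p, W. Qed.

Lemma flat_rebase p q W : flat q W p -> flat q W = flat p W.
Proof.
rewrite /flat /= => pq; apply/seteqP; split=> x /= xq.
- by have := memvB xq pq; rewrite opprB addrA subrK.
- by have := memvD xq pq; rewrite addrA subrK.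
Qed.

(** [U + <[a - p]>] is the linear span of [flat a U] translated by [- p]. *)
Lemma sub_flat p a U Z : flat a U `<=` flat p Z <-> (U + <[a - p]> <= Z)%VS.
Proof.
split=> [sub|/subvP sub x xa].
- have aZ : a - p \in Z by apply: (sub a); rewrite /flat /= subrr mem0v.
  rewrite subv_add -memvE aZ andbT; apply/subvP => u uU.
  have : flat p Z (u + a) by apply: sub; rewrite /flat /= addrK.
  by rewrite /flat /= => /memvB/(_ aZ); rewrite opprB addrA subrK addrK.
- by rewrite /flat /= -(subrK a x) -addrA; apply: sub; rewrite memv_add ?memv_line.
Qed.

(** A flat containing both pieces contains their hull, hence [p]; rebased at [p], it falls under
    [sub_flat]. *)
Lemma affine_hull_flat p a b U V :
  affine_hull (flat a U `|` flat b V) p ->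
  affine_hull (flat a U `|` flat b V)
    = flat p ((U + <[a - p]>) + (V + <[b - p]>)).
Proof.
move=> ph; apply/seteqP; split=> x.
- apply; split; first by eexists; apply: affine_flat.
  by rewrite subUset; split; apply/sub_flat; rewrite ?addvSl ?addvSr.
- move=> xW A [[k [q [Z [dZ AE]]]] sub].
  have : A p by apply: ph; split=> //; exists k, q, Z.
  rewrite {}AE in sub * => /flat_rebase qp; rewrite -/(flat q Z) qp in sub *.
  move: sub; rewrite subUset => -[/sub_flat Us /sub_flat Vs].
  by apply: (subvP _ _ xW); rewrite subv_add Us.
Qed.

(** Non-parallelism makes the directions independent; disjointness keeps [b - a] out of their
    sum. *)
Lemma skew_span_dim a b U V : \dim U = 1%N -> \dim V = 1%N ->
  skew_lines (flat a U) (flat b V) -> \dim (U + V + <[b - a]>) = 3%N.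
Proof.
move=> dU dV [disj npar].
have dUV : \dim (U + V) = 2%N.
  apply/eqP; rewrite eqn_leq; apply/andP; split.
    by have := dimv_add_leqif U V => -[+ _]; rewrite dU dV.
  rewrite ltnNge; apply/negP => d1; apply: npar; exists (b - a).
  have /eqP UE : U == (U + V)%VS by rewrite eqEdim addvSl dU.
  have /eqP VE : V == (U + V)%VS by rewrite eqEdim addvSr dV.
  have {UE VE} <- : U = V by rewrite UE -VE.
  apply/seteqP; split=> [x xb|_ [x xa <-]]; rewrite /flat /=.
    exists (x - (b - a)); last by rewrite subrK.
    by rewrite /flat /= opprB addrA addrAC addrK.
  by rewrite addrA addrAC addrK.
rewrite dimv_add_line ?dUV //; apply/negP => /memv_addP[u uU [v vV bauv]].
apply: disj; exists (a + u); split; rewrite /flat /=; first by rewrite addrC addKr.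
have -> : a + u - b = - v.
  have -> : u = b - a - v by rewrite bauv addrK.
  by rewrite addrA [a + _]addrC subrK addrAC subrr sub0r.
by rewrite memvN.
Qed.

(** Since [p] lies in the hull, this sum and the one in [skew_span_dim] are the same direction
    space, based at [p] and at [a]. *)
Lemma skew_pencil_dim p a b U V : \dim U = 1%N -> \dim V = 1%N ->
  skew_lines (flat a U) (flat b V) ->
  affine_hull (flat a U `|` flat b V) p ->
  \dim ((U + <[a - p]>) + (V + <[b - p]>)) = 3%N.
Proof.
move=> dU dV sk ph; rewrite -(skew_span_dim dU dV sk); congr (\dim _).
set W := (U + V + _)%VS.
have UW : (U <= W)%VS by rewrite /W -addvA addvSl.
have VW : (V <= W)%VS by rewrite (subv_trans (addvSr U V)) ?addvSl.
have baW : b - a \in W by rewrite memvE addvSr.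
have pW : p - a \in W.
  apply: (ph (flat a W)); split; first by eexists; apply: affine_flat.
  rewrite subUset; split; apply/sub_flat; rewrite subv_add -memvE ?subrr ?mem0v ?andbT //.
  by rewrite VW.
have apW : a - p \in W by rewrite -opprB memvN.
have bpW : b - p \in W by rewrite -(subrK a b) -addrA memvD.
apply/eqP; rewrite eqEsubv !subv_add UW VW -!memvE apW bpW /=.
set PU := (U + <[a - p]>)%VS; set PV := (V + <[b - p]>)%VS.
have aP : a - p \in PU by rewrite memvE addvSr.
have bP : b - p \in PV by rewrite memvE addvSr.
have -> : b - a = - (a - p) + (b - p).
  by rewrite opprB [RHS]addrC addrA subrK.
rewrite memv_add ?memvN // andbT.
by rewrite (subv_trans (addvSl U _) (addvSl PU PV)) (subv_trans (addvSl V _) (addvSr PU PV)).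
Qed.

(** The hull of two skew lines inside a 3-flat fills it by dimension, so the base point [q] lies in
    every hull. *)
Lemma central_of_sub_3flat q V (Sigma : set (set 'rV[R]_l)) : \dim V = 3%N ->
  (forall L, Sigma L -> line L) ->
  (forall L M, Sigma L -> Sigma M -> L <> M -> skew_lines L M) ->
  (forall L, Sigma L -> L `<=` flat q V) ->
  central (pair_hulls Sigma).
Proof.
move=> dV hl hs sub; exists q => _ [L [M [SL SM LM ->]]] A [[k [r [Z [_ AE]]]]].
have {}hs := hs _ _ SL SM LM.
have [a [U [dU LE]]] := hl _ SL; have [b [T [dT ME]]] := hl _ SM.
have := sub _ SM; have := sub _ SL; rewrite -!/(flat _ _) in LE ME AE.
rewrite {}LE {}ME in hs *.
move=> /sub_flat; rewrite subv_add -memvE => /andP[UV aV].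
move=> /sub_flat; rewrite subv_add -memvE => /andP[TV bV].
rewrite {}AE subUset => -[sL sM].
have aA : flat r Z a by apply: sL; rewrite /flat /= subrr mem0v.
rewrite (flat_rebase aA) in sL sM *.
move: sL sM => /sub_flat; rewrite subv_add => /andP[UZ _].
move=> /sub_flat; rewrite subv_add => /andP[TZ baZ].
have /eqP WV : (U + T + <[b - a]>)%VS == V.
  rewrite eqEdim (skew_span_dim dU dT hs) dV andbT !subv_add UV TV -memvE /=.
  by have := memvB bV aV; rewrite opprB addrA subrK.
have /subvP WZ : (V <= Z)%VS by rewrite -WV !subv_add UZ TZ.
by apply: WZ; rewrite -opprB memvN.
Qed.

Lemma exists_3flat_above (hl : (4 <= l)%N) a U : \dim U = 1%N ->
  exists2 V, \dim V = 3%N & flat a U `<=` flat a V.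
Proof.
move=> dU; have [|V UV dV] := @exists_subspace_above _ _ U 3.
  by rewrite dU dimvf dim_matrix mul1r; apply: ltnW.
by exists V => // x; apply: (subvP UV).
Qed.

(** Seen from [p], the lines become linear spaces to which [pairwise_spans_coincide] applies; [L0]
    and [M0] supply the 3-flat. *)
Lemma central_in_3flat p (Sigma : set (set 'rV[R]_l)) L0 M0 :
  finite_set Sigma ->
  (forall L, Sigma L -> line L) ->
  (forall L M, Sigma L -> Sigma M -> L <> M -> skew_lines L M) ->
  (forall L M, Sigma L -> Sigma M -> L <> M -> exists N,
     [/\ Sigma N, N <> L, N <> M & N `<=` affine_hull (L `|` M)]) ->
  (\bigcap_(H in pair_hulls Sigma) H) p ->
  Sigma L0 -> Sigma M0 -> L0 <> M0 ->
  exists A, affine_subspace 3 A /\ forall L, Sigma L -> L `<=` A.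
Proof.
move=> /finite_seqP[s ->] hl hs ht hp S0 S1 LM0.
pose I := seq_sub s.
have SI (i : I) : [set` s] (val i) by exact: valP.
have /choice[c cP] (i : I) : exists c : 'rV[R]_l * {vspace 'rV[R]_l},
    \dim c.2 = 1%N /\ val i = flat c.1 c.2.
  by have [a [U [dU iE]]] := hl _ (SI i); exists (a, U).
pose P i := ((c i).2 + <[(c i).1 - p]>)%VS.
have hull (i j : I) : i != j -> affine_hull (val i `|` val j) = flat p (P i + P j).
  move=> ij; have ph : affine_hull (val i `|` val j) p.
    apply: hp; exists (val i), (val j); split=> //.
    by move/val_inj/eqP; rewrite (negPf ij).
  have [_ iE] := cP i; have [_ jE] := cP j; rewrite iE jE in ph *.
  exact: affine_hull_flat ph.
have dP i : (\dim (P i) <= 2)%N.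
  have [di _] := cP i; have := dimv_add_leqif (c i).2 <[(c i).1 - p]> => -[+ _].
  by move/leq_trans; apply; rewrite di dim_vline; case: eqP.
have neqI (i j : I) : i != j -> val i <> val j.
  by move=> ij /val_inj/eqP; rewrite (negPf ij).
have dPP i j : i != j -> \dim (P i + P j) = 3%N.
  move=> ij; have [di iE] := cP i; have [dj jE] := cP j.
  have sk := hs _ _ (SI i) (SI j) (neqI _ _ ij).
  have ph : affine_hull (val i `|` val j) p by rewrite hull // /flat /= subrr mem0v.
  rewrite iE jE in sk ph; exact: skew_pencil_dim ph.
have third i j : i != j -> exists k, [/\ k != i, k != j & (P k <= P i + P j)%VS].
  move=> ij; have [N [SN Ni Nj Nij]] := ht _ _ (SI i) (SI j) (neqI _ _ ij).
  exists (SeqSub SN); split.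
  - by apply/eqP => kE; apply: Ni; rewrite -kE.
  - by apply/eqP => kE; apply: Nj; rewrite -kE.
  rewrite hull // in Nij; have [_ NE] := cP (SeqSub SN).
  by apply/sub_flat; rewrite -NE.
pose i0 : I := SeqSub S0; pose j0 : I := SeqSub S1.
have ij0 : i0 != j0 by apply/eqP => /(congr1 val).
exists (flat p (P i0 + P j0)); split; first by rewrite -(dPP _ _ ij0); exact: affine_flat.
move=> L SL; have [_ /= ->] := cP (SeqSub SL : I).
apply/sub_flat; exact: (pairwise_spans_coincide dP dPP third _ ij0).
Qed.

End Flats.

(** * The equivalence, including families with fewer than two lines *)

Theorem mainTheorem1 (R : realType) (l : nat) (hl : (4 <= l)%N)
    (Sigma : set (set 'rV[R]_l))
    (hfin : finite_set Sigma)
    (hline : forall L : set 'rV[R]_l, Sigma L -> line L)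
    (hskew : forall L M : set 'rV[R]_l,
       Sigma L -> Sigma M -> L <> M -> skew_lines L M)
    (hthird : forall L M : set 'rV[R]_l, Sigma L -> Sigma M -> L <> M ->
       exists N : set 'rV[R]_l,
         [/\ Sigma N, N <> L, N <> M & N `<=` affine_hull (L `|` M)]) :
  (exists A : set 'rV[R]_l,
     affine_subspace 3 A /\ forall L : set 'rV[R]_l, Sigma L -> L `<=` A)
  <-> central (pair_hulls Sigma).
Proof.
split=> [[A [[q [V [dV ->]]] sub]]|[p hp]]; first exact: central_of_sub_3flat dV hline hskew sub.
have [[L [M [SL SM LM]]]|nopair] :=
  pselect (exists L M, [/\ Sigma L, Sigma M & L <> M]).
  exact: central_in_3flat hfin hline hskew hthird hp SL SM LM.
(* With no pair there is at most one line; any 3-flat through it works, or any 3-flat at all if the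
   family is empty. *)
have [[L SL]|noL] := pselect (exists L, Sigma L).
  have [a [U [dU LE]]] := hline _ SL.
  have [V dV sub] := exists_3flat_above hl a dU.
  exists (flat a V); split; first by rewrite -dV; exact: affine_flat.
  move=> M SM; suff -> : M = L by rewrite LE.
  by apply: contrapT => ML; apply: nopair; exists M, L.
have [|V _ dV] := @exists_subspace_above _ 'rV[R]_l 0%VS 3.
  by rewrite dimv0 dimvf dim_matrix mul1r; apply: ltnW.
exists (flat 0 V); split; first by rewrite -dV; exact: affine_flat.
by move=> L SL; case: noL; exists L.
Qed.
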